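(* Let $S$ be a semigroup with finite choice of generators $X$. Then the global cogrowth rate of $S$ with respect to $X$ satisfies $$\gamma^{S,X} \geq \sqrt{|X|},$$ with equality if and only if either $S$ is a free semigroup freely generated by $X$ or $|X| = 1$.
   Context: $X^+$ denotes the free semigroup on a set of symbols $X$ (all finite non-empty words under concatenation), and $|w|$ is the length of a word $w$. A finite choice of generators for a semigroup $S$ is a finite set $X$ of symbols together with a surjective morphism $X^+ \to S$, $w \mapsto \overline{w}$ (several symbols may map to the same element of $S$). ''$S$ is a free semigroup freely generated by $X$'' means that this morphism $X^+\to S$ is an isomorphism. The global cogrowth function $\gamma^{S,X}(n)$ ($n \geq 1$) is the number of pairs $(u,v)$ of non-empty words over $X$ with $|u|+|v| = n$ and $\overline{u} = \overline{v}$ in $S$. The global cogrowth rate is $\gamma^{S,X} = \limsup_{n\to\infty} (\gamma^{S,X}(n))^{1/n}$. *)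

(* Defs.v *)
From HB Require Import structures.
From mathcomp Require Import all_boot all_order all_algebra finmap.
From mathcomp Require Import all_classical all_reals all_analysis.

Set Implicit Arguments.
Unset Strict Implicit.
Unset Printing Implicit Defensive.

Local Open Scope classical_set_scope.

Record free_semigroup (X : Type) := FreeSemigroup {
  word :> seq X;
  word_neq_nil : 0 < size word
}.

HB.instance Definition _ (X : Type) := [isSub for @word X].
HB.instance Definition _ (X : choiceType) :=
  [Choice of free_semigroup X by <:].

Section FreeSemigroup.
Variable X : choiceType.
Implicit Types u v w : free_semigroup X.

Lemma concat_neq_nil u v : 0 < size (word u ++ word v).
Proof. by rewrite size_cat addn_gt0 word_neq_nil. Qed.

Definition concat u v : free_semigroup X := FreeSemigroup (concat_neq_nil u v).

Lemma concatA : associative concat.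
Proof. by move=> u v w; apply/val_inj; rewrite /= catA. Qed.

HB.instance Definition _ :=
  isSemigroup.Build (free_semigroup X) concatA.

End FreeSemigroup.

Section GlobalCogrowth.
Variables (X : finType) (S : semigroupType).
Variable eval : {multiplicative free_semigroup X -> S}.

Definition cogrowth_pairs (n : nat) :
    set (free_semigroup X * free_semigroup X) :=
  [set uv | (size (word uv.1) + size (word uv.2))%N = n /\
            eval uv.1 = eval uv.2].

(* fset_set sends infinite sets to fset0; this rules that case out. *)
Lemma finite_cogrowth_pairs n : finite_set (cogrowth_pairs n).
Proof.
pose B := [set s : seq X | (size s <= n)%N].
have finB : finite_set B.
  pose f (p : {k : 'I_n.+1 & k.-tuple X}) : seq X := tagged p.
  apply: (@sub_finite_set _ _ (f @` setT)); last first.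
    by apply: finite_image; exact: finite_finset.
  move=> s /= sn; have sn' : size s < n.+1 by [].
  exists (Tagged (fun k : 'I_n.+1 => k.-tuple X)
    (i := Ordinal sn') (in_tuple s)) => //.
pose h (uv : free_semigroup X * free_semigroup X) :=
  (word uv.1, word uv.2).
have hinj : injective h.
  by move=> [u v] [u' v'] [/val_inj -> /val_inj ->].
apply: (@sub_finite_set _ _ (h @^-1` (B `*` B))).
  move=> [u v] /= [en _].
  by split; rewrite /B /= -en ?leq_addr ?leq_addl.
apply: finite_preimage; last exact: finite_setX.
by move=> x y _ _; exact: hinj.
Qed.

Definition global_cogrowth (n : nat) : nat :=
  #|` fset_set (cogrowth_pairs n) |%fset.

(* The term at n = 0 is irrelevant for the limsup. *)
Definition global_cogrowth_rate (R : realType) : \bar R :=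
  limn_esup (fun n : nat => (((global_cogrowth n)%:R `^ n%:R^-1)%R)%:E).

Definition freely_generates : Prop := bijective eval.

End GlobalCogrowth.

(* Main.v *)
Require Import Defs.
From HB Require Import structures.
From mathcomp Require Import all_boot all_order all_algebra finmap.
From mathcomp Require Import all_classical all_reals all_analysis.
From mathcomp Require Import lra.

(** Everything rests on one way of producing many pairs of words with equal
    value. Take a finite family B of pairs (f b, g b) of words, each pair
    having equal values in S and total length L, and concatenate m of these
    pairs componentwise. The results have equal values and total length L m.
    If the sequence of blocks can be decoded from the resulting pair
    ([pair_code]), then there are at least #|B| ^ m pairs of length L m, and
    the cogrowth rate is at least the L-th root of #|B|
    ([global_cogrowth_rate_ge]).

    For the lower bound, the blocks are the diagonal pairs (x, x) of letters,
    with L = 2.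

    If eval is not injective and there are at least two letters, one more block
    can be squeezed in. A relation between two different words may be chosen so
    that they branch, as p a s and p b t with a <> b: if one word is a prefix of
    the other, append to both a letter that differs from the next letter of the
    longer one. Let N be the total length of this relation u = v. As blocks take
    all the diagonal pairs of words of length N, together with (uu, vv), all of
    total length 2N. A diagonal block cannot be confused with (uu, vv), because
    it forces agreement of both components on the first N letters whereas uu
    and vv branch before that. Hence the rate is at least the 2N-th root of
    #|X| ^ N + 1, which exceeds the square root of #|X|
    ([sqrt_card_lt_rate]).

    In the two remaining cases the upper bound is a direct count: when eval is
    injective only diagonal pairs contribute, and over one letter a pair of
    given total length is determined by the length of its first component, so
    that the count is at most linear. *)

Set Implicit Arguments.
Unset Strict Implicit.
Unset Printing Implicit Defensive.

Import Order.TTheory GRing.Theory Num.Theory.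

(** * Exponential growth rates *)

Lemma powR_root_expr (R : realType) (c : R) (n : nat) :
  (0 <= c -> 0 < n%:R :> R -> (c ^+ n) `^ n%:R^-1 = c)%R.
Proof.
move=> c0 n0; rewrite -powR_mulrn// -powRrM mulfV ?powRr1//.
by rewrite lt0r_neq0.
Qed.

Lemma le_limn_esup_root (R : realType) (u : nat -> R) (c : R) :
  (0 <= c)%R ->
  (forall N, exists2 n, (N < n)%N & (c ^+ n <= u n)%R) ->
  (c%:E <= limn_esup (fun n => (u n `^ n%:R^-1)%R%:E))%E.
Proof.
move=> c0 cu; apply: le_ereal_inf_tmp => _ [V [N _ NV] <-].
have [n Nn cun] := cu N.
have n0 : (0 < n%:R :> R)%R by rewrite ltr0n (leq_ltn_trans _ Nn).
apply: le_ereal_sup_tmp; exists (u n `^ n%:R^-1)%R%:E.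
  by exists n => //; apply: NV; exact: ltnW.
rewrite lee_fin -{1}(powR_root_expr c0 n0).
have cn0 : (0 <= c ^+ n)%R by rewrite exprn_ge0.
apply: ge0_ler_powR; rewrite ?nnegrE ?invr_ge0//.
exact: le_trans cun.
Qed.

Lemma limn_esup_root_le (R : realType) (u : nat -> R) (c : R) (N : nat) :
  (0 <= c)%R -> (forall n, 0 <= u n)%R ->
  (forall n, (N <= n)%N -> (u n <= c ^+ n)%R) ->
  (limn_esup (fun n => (u n `^ n%:R^-1)%R%:E) <= c%:E)%E.
Proof.
move=> c0 u0 uc; apply: ge_ereal_inf.
pose V := [set n | (N < n)%N]%classic.
exists (ereal_sup [set (u n `^ n%:R^-1)%R%:E | n in V]%classic).
  by exists V => //; exists N.+1.
apply: ge_ereal_sup => _ [n /= Nn <-].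
have n0 : (0 < n%:R :> R)%R by rewrite ltr0n (leq_ltn_trans _ Nn).
rewrite lee_fin -[leRHS](powR_root_expr c0 n0).
by apply: ge0_ler_powR; rewrite ?nnegrE ?invr_ge0 ?exprn_ge0 ?uc// ltnW.
Qed.

(** * Counting pairs of words *)

(** This lemma and the next bound the count by that of a family h indexed by a
    finite type: from below by an injective family, from above by one that
    reaches every pair. *)
Lemma leq_global_cogrowth (T X : finType) (S : semigroupType)
    (eval : {multiplicative free_semigroup X -> S}) (n : nat)
    (h : T -> free_semigroup X * free_semigroup X) :
  injective h -> (forall t, cogrowth_pairs eval n (h t)) ->
  #|T| <= global_cogrowth eval n.
Proof.
move=> hinj hP; rewrite /global_cogrowth.
have <- : #|` [fset h t | t in T]%fset| = #|T|.
  by rewrite card_imfset //= -cardE.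
apply: fsubset_leq_card; apply/fsubsetP => p /imfsetP [t _ ->].
by rewrite in_fset_set ?inE; [exact: hP | exact: finite_cogrowth_pairs].
Qed.

Lemma global_cogrowth_leq (T X : finType) (S : semigroupType)
    (eval : {multiplicative free_semigroup X -> S}) (n : nat)
    (h : T -> free_semigroup X * free_semigroup X) :
  (forall p, cogrowth_pairs eval n p -> exists t, p = h t) ->
  global_cogrowth eval n <= #|T|.
Proof.
move=> hP; rewrite /global_cogrowth.
have le : #|` [fset h t | t in T]%fset| <= #|T|.
  by rewrite (leq_trans (leq_imfset_card _ _ _)) //= -cardE.
apply: leq_trans le; apply: fsubset_leq_card; apply/fsubsetP => p.
rewrite in_fset_set ?inE => [/hP[t ->]|]; last exact: finite_cogrowth_pairs.
by apply/imfsetP; exists t.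
Qed.

(** * Products of blocks *)

(** The block b0, which comes last, keeps the product non-empty when bs is
    empty. *)
Definition word_prod (X : finType) (B : Type) (f : B -> free_semigroup X)
    (b0 : B) (bs : seq B) : free_semigroup X :=
  foldr (fun b w => concat (f b) w) (f b0) bs.

(** The first block of a concatenation of pairs can be read off from it,
    whatever follows: a prefix property, but for both components at once. *)
Definition pair_code (X : finType) (B : Type) (f g : B -> free_semigroup X) :=
  forall b b' (s t s' t' : seq X),
    f b ++ s = f b' ++ s' -> g b ++ t = g b' ++ t' -> b = b'.

Lemma eval_concat (X : finType) (S : semigroupType)
    (eval : {multiplicative free_semigroup X -> S}) (u v : free_semigroup X) :
  eval (concat u v) = (eval u * eval v)%g.
Proof. exact: gmulfM. Qed.

Lemma eval_word_prod (X : finType) (S : semigroupType) (B : Type)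
    (eval : {multiplicative free_semigroup X -> S})
    (f g : B -> free_semigroup X) (b0 : B) (bs : seq B) :
  (forall b, eval (f b) = eval (g b)) ->
  eval (word_prod f b0 bs) = eval (word_prod g b0 bs).
Proof.
move=> fg; elim: bs => [|b bs IH] //=.
by rewrite !eval_concat fg IH.
Qed.

Lemma size_word_prod (X : finType) (B : Type) (f g : B -> free_semigroup X)
    (L : nat) (b0 : B) (bs : seq B) :
  (forall b, size (f b) + size (g b) = L) ->
  size (word_prod f b0 bs) + size (word_prod g b0 bs) = L * (size bs).+1.
Proof.
move=> fgL; elim: bs => [|b bs IH] /=; first by rewrite fgL muln1.
by rewrite !size_cat addnACA fgL IH -mulnS.
Qed.

Lemma word_prod_inj (X : finType) (B : Type) (f g : B -> free_semigroup X)
    (b0 b0' : B) (bs bs' : seq B) :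
  pair_code f g -> size bs = size bs' ->
  word_prod f b0 bs = word_prod f b0' bs' ->
  word_prod g b0 bs = word_prod g b0' bs' -> b0 = b0' /\ bs = bs'.
Proof.
move=> code; elim: bs bs' => [|b bs IH] [|b' bs'] //=.
  move=> _ ef eg; split=> //.
  by apply: (code _ _ [::] [::] [::] [::]); rewrite !cats0 ?ef ?eg.
move=> [es] /(congr1 (@word X)) /= ef /(congr1 (@word X)) /= eg.
have bb' : b = b' by exact: code ef eg.
move: ef eg; rewrite bb' => /eqP; rewrite eqseq_cat// eqxx => /eqP/val_inj ef.
move=> /eqP; rewrite eqseq_cat// eqxx => /eqP/val_inj eg.
by have [-> ->] := IH _ es ef eg.
Qed.

(** By [word_prod_inj], different sequences of m.+1 blocks give different
    pairs. *)
Lemma expn_leq_global_cogrowth (X B : finType) (S : semigroupType)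
    (eval : {multiplicative free_semigroup X -> S})
    (f g : B -> free_semigroup X) (L m : nat) :
  pair_code f g -> (forall b, eval (f b) = eval (g b)) ->
  (forall b, size (f b) + size (g b) = L) ->
  #|B| ^ m.+1 <= global_cogrowth eval (L * m.+1).
Proof.
move=> code fg fgL; rewrite expnS -card_tuple -card_prod.
pose h (t : B * m.-tuple B) := (word_prod f t.1 t.2, word_prod g t.1 t.2).
apply: (@leq_global_cogrowth _ _ _ _ _ h).
  move=> [b t] [b' t'] [ef eg].
  have [|-> /val_inj -> //] := word_prod_inj code _ ef eg.
  by rewrite !size_tuple.
move=> [b t]; split=> /=; last exact: eval_word_prod.
by rewrite (size_word_prod _ _ fgL) size_tuple.
Qed.

Lemma global_cogrowth_rate_ge (R : realType) (X B : finType)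
    (S : semigroupType) (eval : {multiplicative free_semigroup X -> S})
    (f g : B -> free_semigroup X) (L : nat) (c : R) :
  0 < L -> pair_code f g -> (forall b, eval (f b) = eval (g b)) ->
  (forall b, size (f b) + size (g b) = L) ->
  (0 <= c)%R -> (c ^+ L <= #|B|%:R)%R ->
  (c%:E <= global_cogrowth_rate eval R)%E.
Proof.
move=> L0 code fg fgL c0 cB; apply: le_limn_esup_root => // N.
exists (L * N.+1); first by rewrite leq_pmull.
apply: (@le_trans _ _ (#|B| ^ N.+1)%:R%R); last first.
  by rewrite ler_nat (expn_leq_global_cogrowth N code fg fgL).
by rewrite exprM natrX lerXn2r ?nnegrE ?exprn_ge0.
Qed.

Definition letter (X : finType) (x : X) : free_semigroup X :=
  @FreeSemigroup X [:: x] isT.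

Lemma sqrt_card_le_rate (R : realType) (X : finType) (S : semigroupType)
    (eval : {multiplicative free_semigroup X -> S}) :
  ((Num.sqrt (#|X|%:R : R)%R)%:E <= global_cogrowth_rate eval R)%E.
Proof.
apply: (@global_cogrowth_rate_ge _ _ X _ _ (@letter X) (@letter X) 2) => //.
  by move=> b b' s t s' t' [].
by rewrite sqr_sqrtr.
Qed.

(** * A nontrivial relation *)

Lemma seq_branch (X : eqType) (u v : seq X) :
  u <> v ->
  (exists p a b s t, [/\ a <> b, u = p ++ a :: s & v = p ++ b :: t]) \/
  (exists y s, u = v ++ y :: s \/ v = u ++ y :: s).
Proof.
elim: u v => [|x u IH] [|y v] // uv.
- by right; exists y, v; right.
- by right; exists x, u; left.
have [xy|/eqP xy] := eqVneq x y; last first.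
  by left; exists [::], x, y, u, v.
move: uv; rewrite -xy => uv {xy y}.
have [|[p [a [b [s [t [ab -> ->]]]]]]|[y [s H]]] := IH v.
- by move=> e; apply: uv; rewrite e.
- by left; exists (x :: p), a, b, s, t.
- by right; exists y, s; case: H => ->; [left|right].
Qed.

(** Two words that differ either branch, or one is a prefix of the other; in
    the latter case a second letter is available to make them branch. *)
Lemma branching_relation (X : finType) (S : semigroupType)
    (eval : {multiplicative free_semigroup X -> S}) :
  1 < #|X| -> ~ injective eval ->
  exists (u v : free_semigroup X) p a b s t,
    [/\ eval u = eval v, a <> b, word u = p ++ a :: s & word v = p ++ b :: t].
Proof.
move=> X2 ninj.
have [u [v [euv uv]]] : exists u v, eval u = eval v /\ u <> v.
  apply: contrapT => H; apply: ninj => u v euv; apply: contrapT => uv.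
  by apply: H; exists u, v.
have {}uv : word u <> word v by move=> /val_inj.
have [[p [a [b [s [t [ab eu ev]]]]]]|[y [s H]]] := seq_branch uv.
  by exists u, v, p, a, b, s, t.
have [a ay] : exists a, a <> y.
  have /card_gt0P[a] : 0 < #|[set~ y]%SET| by rewrite cardsC1 -subn1 subn_gt0.
  by rewrite !inE => /eqP; exists a.
wlog {H uv} H : u v euv / word v = word u ++ y :: s.
  by move=> W; case: H => [/(W v u (esym euv))|/(W u v euv)].
(* Here v continues u with the letter y; after appending a <> y to both words,
   they branch at position [size u]. *)
exists (concat u (letter a)), (concat v (letter a)), (word u), a, y, [::].
exists (s ++ [:: a]); split=> //=; first by rewrite !eval_concat euv.
by rewrite H -catA.
Qed.

Lemma branch_no_common_prefix (X : eqType) (w p : seq X) (a b : X)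
    (s t s' t' : seq X) :
  size p < size w -> w ++ s = p ++ a :: s' -> w ++ t = p ++ b :: t' -> a = b.
Proof.
elim: w p => [|x w IH] [|y p] //=; first by move=> _ [<- _] [].
by rewrite ltnS => pw [_ e1] [_ e2]; exact: IH e1 e2.
Qed.

Lemma size_tuple_gt0 (X : Type) (N : nat) (w : N.+1.-tuple X) : 0 < size w.
Proof. by rewrite size_tuple. Qed.

Definition tuple_word (X : finType) (N : nat) (w : N.+1.-tuple X) :
  free_semigroup X := FreeSemigroup (size_tuple_gt0 w).

(** The value None of the index stands for the extra block (u, v), and Some w
    for the diagonal block (w, w). Two diagonal blocks that start the same pair
    agree, having the same length; and a diagonal block cannot start the same
    pair as (u, v), since the branching point of the latter comes within the
    first N.+1 letters. *)
Lemma pair_code_branch (X : finType) (N : nat) (u v : free_semigroup X)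
    (p : seq X) (a b : X) (s t : seq X) :
  a <> b -> word u = p ++ a :: s -> word v = p ++ b :: t -> size p < N.+1 ->
  pair_code (fun o => oapp (@tuple_word X N) u o)
            (fun o => oapp (@tuple_word X N) v o).
Proof.
move=> ab eu ev pN [w|] [w'|] s1 t1 s2 t2 //=; rewrite ?eu ?ev -?catA.
- by move/eqP; rewrite eqseq_cat ?size_tuple// => /andP[/eqP/val_inj ->].
- move=> e1 e2; case: ab.
  by apply: branch_no_common_prefix e1 e2; rewrite size_tuple.
- move=> /esym e1 /esym e2; case: ab.
  by apply: branch_no_common_prefix e1 e2; rewrite size_tuple.
Qed.

(** Adding the block coming from a nontrivial relation raises the number of
    blocks from #|X| ^ N.+1 to #|X| ^ N.+1 + 1 for the same total length. *)
Lemma sqrt_card_lt_rate (R : realType) (X : finType) (S : semigroupType)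
    (eval : {multiplicative free_semigroup X -> S}) :
  1 < #|X| -> ~ injective eval ->
  ((Num.sqrt (#|X|%:R : R)%R)%:E < global_cogrowth_rate eval R)%E.
Proof.
move=> X2 ninj.
have [u [v [p [a [b [s [t [euv ab eu ev]]]]]]]] := branching_relation X2 ninj.
pose N := (size u + size v).-1.
have EN : N.+1 = size u + size v.
  by rewrite /N prednK// addn_gt0 word_neq_nil.
have pN : size p < N.+1.
  by rewrite EN eu size_cat /= addnS addSn ltnS -addnA leq_addr.
(* Doubling the relation makes its total length even, hence equal to that of a
   diagonal block, and leaves the branching point where it was. *)
pose f o := oapp (@tuple_word X N) (concat u u) o.
pose g o := oapp (@tuple_word X N) (concat v v) o.
have code : pair_code f g.
  apply: (pair_code_branch (p := p) (s := s ++ u) (t := t ++ v) ab) => //=.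
    by rewrite {1}eu -catA.
  by rewrite {1}ev -catA.
pose M := (#|X| ^ N.+1).+1.
pose L := N.+1 + N.+1.
have L0 : 0 < L by [].
pose c : R := ((M%:R : R) `^ L%:R^-1)%R.
have cL : (c ^+ L = M%:R)%R.
  by rewrite /c -powR_mulrn ?powR_ge0// -powRrM mulVf ?powRr1// pnatr_eq0.
apply: (@lt_le_trans _ _ c%:E); last first.
  apply: (global_cogrowth_rate_ge (B := option (N.+1.-tuple X)) L0 code).
  - by case=> [w|] //=; rewrite !eval_concat euv.
  - case=> [w|] /=; first by rewrite size_tuple.
    by rewrite !size_cat addnACA -EN.
  - exact: powR_ge0.
  - by rewrite cL card_option card_tuple.
rewrite lte_fin -(ltr_pXn2r L0) ?nnegrE ?powR_ge0 ?sqrtr_ge0// cL.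
by rewrite /L addnn -mul2n exprM sqr_sqrtr// -natrX ltr_nat.
Qed.

(** * Equality cases *)

(** Only the diagonal pairs (u, u) occur: #|X| ^ m of them for n = 2m, and none
    for odd n. *)
Lemma rate_free_le (R : realType) (X : finType) (S : semigroupType)
    (eval : {multiplicative free_semigroup X -> S}) :
  injective eval ->
  (global_cogrowth_rate eval R <= (Num.sqrt (#|X|%:R : R)%R)%:E)%E.
Proof.
move=> inj; apply: (@limn_esup_root_le _ _ _ 1) => // n n0.
have size_eq p : cogrowth_pairs eval n p -> p.1 = p.2 /\ n = (size p.1).*2.
  by case: p => u v [/= <- /inj ->]; rewrite addnn.
have [m [En|En]] : exists m, n = m.+1.*2 \/ n = m.*2.+1.
  case: n n0 {size_eq} => // n _; exists n./2.
  by have := odd_double_half n; case: (odd n) => e; [left|right]; rewrite -{1}e.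
- apply: (@le_trans _ _ (#|X| ^ m.+1)%:R%R).
    rewrite ler_nat -card_tuple.
    pose h (w : m.+1.-tuple X) := (tuple_word w, tuple_word w).
    apply: (@global_cogrowth_leq _ _ _ _ _ h) => -[u v] /size_eq /= [<- Eu].
    have su : size u == m.+1 by rewrite -(inj_eq double_inj) -Eu En.
    by exists (Tuple su); congr pair; apply: val_inj.
  by rewrite En -mul2n exprM sqr_sqrtr// natrX.
- rewrite (_ : global_cogrowth eval n = 0) ?exprn_ge0 ?sqrtr_ge0//.
  apply/eqP; rewrite -leqn0 -card_void.
  apply: (@global_cogrowth_leq _ _ _ _ _ (of_void _)) => p /size_eq [_ Ep].
  by have := congr1 odd Ep; rewrite En /= !odd_double.
Qed.

Lemma bernoulli_ineq (R : realDomainType) (x : R) (n : nat) :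
  (0 <= x -> 1 + x *+ n <= (1 + x) ^+ n)%R.
Proof.
move=> x0; elim: n => [|n IH]; first by rewrite mulr0n addr0.
rewrite exprS; apply: le_trans (ler_wpM2l _ IH); last by rewrite addr_ge0.
have := mulr_ge0 x0 (mulrn_wge0 n x0).
by rewrite mulrS; move: (x *+ n)%R => y xy0; lra.
Qed.

(** There are at most n + 1 pairs of total length n, and n + 1 is eventually
    below (1 + e) ^ n for each e > 0: writing 1 + e = (1 + y) ^ 2, Bernoulli's
    inequality gives (1 + e) ^ n >= (1 + n y) ^ 2 >= 1 + n ^ 2 y ^ 2, which is
    at least 1 + n as soon as n y ^ 2 >= 1. *)
Lemma rate_one_letter_le (R : realType) (X : finType) (S : semigroupType)
    (eval : {multiplicative free_semigroup X -> S}) :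
  #|X| = 1 -> (global_cogrowth_rate eval R <= 1)%E.
Proof.
move=> X1; have /card_gt0P[x _] : 0 < #|X| by rewrite X1.
have X1E (y : X) : y = x.
  by apply/esym/eqP; have /fintype_le1P/(_ x y) -> : #|X| <= 1 by rewrite X1.
have nseqE (w : free_semigroup X) : word w = nseq (size w).-1.+1 x.
  rewrite prednK ?word_neq_nil//; apply/all_pred1P/allP => y _ /=.
  by rewrite [y]X1E eqxx.
have count n : global_cogrowth eval n <= n.+1.
  rewrite -[n.+1]card_ord.
  pose w k : free_semigroup X := @FreeSemigroup X (nseq k.+1 x) isT.
  (* The lengths are i + 1 and n - i - 1, as words are non-empty. *)
  pose h (i : 'I_n.+1) := (w i, w (n.-2 - i)).
  apply: (@global_cogrowth_leq _ _ _ _ _ h) => -[u v] [/= En _].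
  have lt_un : (size u).-1 < n.+1.
    by rewrite ltnS -En (leq_trans (leq_pred _)) ?leq_addr.
  exists (Ordinal lt_un); congr pair; apply: val_inj; rewrite /= [LHS]nseqE//=.
  congr (_ :: nseq _ _); rewrite -En.
  case: (size u) (word_neq_nil u) => // i _.
  case: (size v) (word_neq_nil v) => // j _.
  by rewrite addnS addSn /= addKn.
apply/lee_addgt0Pr => e e0; rewrite -EFinD.
have [y y0 ye] : exists2 y : R, (0 < y)%R & ((1 + y) ^+ 2 = 1 + e)%R.
  exists (Num.sqrt (1 + e) - 1)%R.
    by rewrite subr_gt0 -{1}(@sqrtr1 R) ltr_sqrt ?ltrDl// addr_gt0.
  by rewrite addrC subrK sqr_sqrtr// addr_ge0// ltW.
pose N := (Num.truncn (y ^- 2)).+1.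
apply: (@limn_esup_root_le _ _ _ N) => //; first by rewrite addr_ge0// ltW.
move=> n Nn.
apply: (@le_trans _ _ n.+1%:R%R); first by rewrite ler_nat.
rewrite -ye exprAC; apply: (@le_trans _ _ ((1 + y *+ n) ^+ 2)%R); last first.
  have y0' : (0 <= y)%R by exact: ltW.
  rewrite lerXn2r ?bernoulli_ineq ?nnegrE ?exprn_ge0 ?addr_ge0//.
  by rewrite mulrn_wge0.
have ny : (1 <= n%:R * y ^+ 2)%R.
  rewrite -ler_pdivrMr ?exprn_gt0// div1r ltW//.
  by apply: (@lt_le_trans _ _ N%:R%R); rewrite ?ler_nat// truncnS_gt.
have n0 : (0 <= n%:R :> R)%R by [].
rewrite -(mulr_natr y n) -natr1; nra.
Qed.

Theorem theorem4p20 (R : realType) (X : finType) (S : semigroupType)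
    (eval : {multiplicative free_semigroup X -> S})
    (eval_surj : forall s : S, exists w : free_semigroup X, eval w = s) :
  ((Num.sqrt (#|X|%:R : R)%R)%:E <= global_cogrowth_rate eval R)%E /\
  (global_cogrowth_rate eval R = (Num.sqrt (#|X|%:R : R)%R)%:E <->
     freely_generates eval \/ #|X| = 1%N).
Proof.
have lb := sqrt_card_le_rate R eval.
split=> //; split=> [eqr|[/bij_inj inj|X1]]; last 2 first.
- by apply/eqP; rewrite eq_le lb andbT rate_free_le.
- by apply/eqP; rewrite eq_le lb andbT X1 sqrtr1 rate_one_letter_le.
have [|X1] := eqVneq #|X| 1%N; [by right|left].
suff inj : injective eval.
  rewrite /freely_generates -setTT_bijective; split=> //.
  - by move=> u v _ _; exact: inj.
  - by move=> s _; have [w <-] := eval_surj s; exists w.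
(* Without letters there are no words, so that eval is injective vacuously. *)
have [X2|] := ltnP 1 #|X|.
  apply: contrapT => /(sqrt_card_lt_rate R X2).
  by rewrite eqr ltxx.
rewrite leq_eqVlt (negPf X1) ltnS leqn0 => /eqP/card0_eq X0.
by move=> [[|x u]] //; have := X0 x.
Qed.
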